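(* Let $m,l,\hbar>0$, $\mu\in\mathbb{N}$ ($\mu\ge1$), $\beta>0$, and let $f^1_{\mu,\beta}(x,t)=|\Psi_{\mu,\beta}(x,t)|^2$ for $0\le x\le l$, $t\in\mathbb{R}$. Then $$f^1_{\mu,\beta}(x,t)=\frac{1}{N(\beta)}\sum_{n,k=-\infty}^{+\infty}e^{-\frac{\pi\beta}{4}\left[(2k+1)^2+(2n+1)^2\right]}\,T_{|k-n|}\!\left(\cos\vartheta^\mu_{n,k}(x,t)\right),$$ where $$\vartheta^\mu_{n,k}(x,t)=\pi\left(2\mu\frac{x}{l}+1\right)-\frac{\pi t}{\mathcal{T}_\mu}(n+k+1),\qquad \mathcal{T}_\mu=\frac{\pi\hbar}{4E_\mu}=\frac{ml^2}{2\pi\hbar\mu^2},$$ and $f^1_{\mu,\beta}$ is periodic in $t$ with period $\mathcal{T}_\mu$; in particular $f^1_{\mu,\beta}(x,0)=f^1_{\mu,\beta}(x,\mathcal{T}_\mu)$.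
   Context: $\theta_1(z,\tau)=\sum_{k\in\mathbb{Z}}e^{\,i\frac{\pi\tau}{4}(2k+1)^2+i\frac{\pi}{2}(2z+1)(2k+1)}$ for $z\in\mathbb{C}$, $\operatorname{Im}\tau>0$. $N(\beta)=l\sum_{k\in\mathbb{Z}}e^{-\frac{\pi\beta}{2}(2k+1)^2}$. $\Psi_{\mu,\beta}(x,t)=\frac{1}{\sqrt{N(\beta)}}\theta_1\left(\mu\frac{x}{l},-\mu^2\frac{2\pi\hbar}{ml^2}t+i\beta\right)$. $E_\mu=\frac{\pi^2\hbar^2\mu^2}{2ml^2}$. $T_j$ denotes the Chebyshev polynomial of the first kind, $T_j(\cos\phi)=\cos(j\phi)$; $\mathcal{T}_\mu$ is a time period (not a Chebyshev polynomial). *)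

(* Defs.v *)
From HB Require Import structures.
From mathcomp Require Import all_boot all_order all_algebra complex.
From mathcomp Require Import boolp classical_sets reals topology normedtype.
From mathcomp Require Import sequences exp trigo ring.
From mathcomp.analysis.showcase Require Import summability.

Set Implicit Arguments.
Unset Strict Implicit.
Unset Printing Implicit Defensive.

Import Order.TTheory GRing.Theory Num.Theory numFieldNormedType.Exports.

Local Open Scope ring_scope.
Local Open Scope complex_scope.

(* Series indexed by int or by int * int are unordered sums: limits of the
   finite partial sums along the filter [totally] of finite index sets.
   [summability.sum] is total and meaningful when that limit exists. *)

Definition cexp (R : realType) (z : R[i]) : R[i] :=
  let: a +i* b := z in (expR a)%:C * (cos b +i* sin b).

Definition theta1 (R : realType) (z tau : R[i]) : R[i] :=
  summability.sum (fun k : int =>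
    cexp ('i%C * (pi%:C * tau / 4) * (2 * k%:~R + 1) ^+ 2
          + 'i%C * (pi%:C / 2) * (2 * z + 1) * (2 * k%:~R + 1)) : R[i]^o).

Definition normN (R : realType) (l beta : R) : R :=
  l * summability.sum (fun k : int =>
        expR (- (pi * beta / 2) * (2 * k%:~R + 1) ^+ 2) : R).

Definition Psi (R : realType) (m l hbar : R) (mu : nat) (beta x t : R) : R[i] :=
  (1 / Num.sqrt (normN l beta))%:C *
  theta1 (mu%:R * (x / l))%:C
         (- (mu%:R ^+ 2 * (2 * pi * hbar / (m * l ^+ 2)) * t) +i* beta).

Definition density (R : realType) (m l hbar : R) (mu : nat) (beta x t : R) : R :=
  Normc.normc (Psi m l hbar mu beta x t) ^+ 2.

Definition energy (R : realType) (m l hbar : R) (mu : nat) : R :=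
  pi ^+ 2 * hbar ^+ 2 * mu%:R ^+ 2 / (2 * m * l ^+ 2).

Definition period (R : realType) (m l hbar : R) (mu : nat) : R :=
  pi * hbar / (4 * energy m l hbar mu).

Fixpoint chebyshevT (R : nzRingType) (j : nat) : {poly R} :=
  match j with
  | 0 => 1
  | 1 => 'X
  | (i.+1 as i1).+1 => 2%:R *: ('X * chebyshevT R i1) - chebyshevT R i
  end.

Lemma chebyshevT_cos (R : realType) (j : nat) (phi : R) :
  (chebyshevT R j).[cos phi] = cos (j%:R * phi).
Proof.
suff: (chebyshevT R j).[cos phi] = cos (j%:R * phi) /\
      (chebyshevT R j.+1).[cos phi] = cos (j.+1%:R * phi) by case.
elim: j => [|j [IH0 IH1]]; first by rewrite mul0r mul1r cos0 !hornerE.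
split=> //; rewrite -[chebyshevT R j.+2]/(2%:R *: ('X * chebyshevT R j.+1)
  - chebyshevT R j) hornerD hornerN hornerZ hornerM hornerX IH0 IH1.
have -> : j%:R * phi = j.+1%:R * phi - phi.
  by rewrite -natr1 mulrDl mul1r addrK.
have -> : j.+2%:R * phi = j.+1%:R * phi + phi.
  by rewrite -[j.+2%:R]natr1 mulrDl mul1r.
by rewrite cosB cosD; ring.
Qed.

Definition vartheta (R : realType) (m l hbar : R) (mu : nat) (n k : int)
    (x t : R) : R :=
  pi * (2 * mu%:R * (x / l) + 1)
  - pi * t / period m l hbar mu * (n + k + 1)%:~R.

Definition density_term (R : realType) (m l hbar : R) (mu : nat) (beta x t : R)
    (p : int * int) : R :=
  let: (n, k) := p in
  expR (- (pi * beta / 4) * ((2 * k%:~R + 1) ^+ 2 + (2 * n%:~R + 1) ^+ 2))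
  * (chebyshevT R `|k - n|%N).[cos (vartheta m l hbar mu n k x t)].

(* Main.v *)
(* The k-th term of theta_1 is w_k exp(i phi_k), where w_k is Gaussian in k and
   phi_k - phi_n = (k - n) vartheta_(n,k).  As the w_k are summable, the square
   |sum_k w_k exp(i phi_k)|^2 expands into the double series
   sum_(n,k) w_n w_k cos (phi_k - phi_n), and cos (j y) = T_|j| (cos y).
   Shifting t by one period changes (k - n) vartheta_(n,k) by
   pi (k - n) (n + k + 1) = pi (k (k + 1) - n (n + 1)), a multiple of 2 pi. *)
Require Import Defs.
From HB Require Import structures.
From mathcomp Require Import all_boot all_order all_algebra complex finmap.
From mathcomp Require Import boolp classical_sets reals topology normedtype.
From mathcomp Require Import sequences exp trigo ring lra.
From mathcomp.analysis.showcase Require Import summability.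
Import Order.TTheory GRing.Theory Num.Theory numFieldNormedType.Exports.
Local Open Scope classical_set_scope.
Local Open Scope ring_scope.

Set Implicit Arguments.
Unset Strict Implicit.

#[local] Existing Instance totally_filter.

(** * Algebra and monotonicity of finite partial sums *)

Lemma partial_sumE (I : choiceType) (V : zmodType) (f : I -> V) (A : {fset I}) :
  partial_sum f A = \sum_(i <- A) f i.
Proof. by rewrite /partial_sum big_seq_fsetE. Qed.

Lemma partial_sumD (I : choiceType) (V : zmodType) (f g : I -> V) :
  partial_sum (f \+ g) = partial_sum f \+ partial_sum g.
Proof. by apply/funext => A; rewrite /partial_sum big_split. Qed.

Lemma partial_sumM (I J : choiceType) (V : pzRingType) (f : I -> V) (g : J -> V)
    (A : {fset I}) (B : {fset J}) :
  partial_sum (fun p => f p.1 * g p.2) (A `*` B)%fset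
  = partial_sum f A * partial_sum g B.
Proof.
rewrite !partial_sumE mulr_suml.
transitivity (\sum_(p <- [seq (i, j) | i <- enum_fset A, j <- enum_fset B])
    f p.1 * g p.2).
  apply: perm_big; apply: uniq_perm; rewrite ?fset_uniq //.
    by rewrite allpairs_uniq ?fset_uniq // => -[a b] [c d].
  move=> [i j]; rewrite in_fsetM /=; apply/andP/allpairsP => [[iA jB]|].
    by exists (i, j).
  by move=> [[a b]] [/= aA bB [-> ->]].
rewrite big_allpairs; apply: eq_bigr => i _.
by rewrite mulr_sumr.
Qed.

Lemma partial_sum_ge0 (I : choiceType) (V : numDomainType) (f : I -> V)
    (A : {fset I}) :
  (forall i, 0 <= f i) -> 0 <= partial_sum f A.
Proof. by move=> f0; apply: sumr_ge0 => i _. Qed.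

Lemma partial_sum_subset (I : choiceType) (V : numDomainType) (f : I -> V)
    (A B : {fset I}) :
  (forall i, 0 <= f i) -> (A `<=` B)%fset -> partial_sum f A <= partial_sum f B.
Proof.
move=> f0 AB; rewrite !partial_sumE.
(* Cutting [f] off to 0 outside [A] lets both sums range over [B]. *)
pose g i := if i \in A then f i else 0.
rewrite (@eq_big_seq _ _ _ _ A f g) /g => [|i ->] //.
rewrite (big_fset_incl _ AB) => [|i _ /negbTE -> //].
by apply: ler_sum => i _; case: ifP.
Qed.

Lemma totally_superset (I : choiceType) (A : {fset I}) :
  \forall B \near totally, (A `<=` B)%fset.
Proof. by exists A. Qed.

(** * Convergence criteria for unordered sums *)

(** The partial sums increase with the index set, so they tend to their supremum. *)
Lemma cvg_partial_sum_nneg (R : realType) (I : choiceType) (f : I -> R) (M : R) :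
  (forall i, 0 <= f i) -> (forall A, partial_sum f A <= M) ->
  cvg (partial_sum f @ totally).
Proof.
move=> f0 fM; pose E := range (partial_sum f).
have hasE : has_sup E.
  split; first by exists (partial_sum f fset0), fset0.
  by exists M => _ [A _ <-].
apply/cvg_ex; exists (sup E); apply/cvgrPdist_le => e e0.
have [_ [A _ <-] Ae] := sup_adherent e0 hasE.
near=> B.
have AB : (A `<=` B)%fset by near: B; exact: totally_superset.
have := partial_sum_subset f0 AB.
have : partial_sum f B <= sup E by apply: (ub_le_sup hasE.2); exists B.
by move=> Bs AleB; rewrite ger0_norm ?subr_ge0 //; lra.
Unshelve. all: by end_near. Qed.

(** Write [f] as [(f + w) - w]: both parts are nonnegative, with partial sums bounded by [M + M] and
    [M]. *)
Lemma cvg_partial_sum_dominated (R : realType) (I : choiceType) (f w : I -> R)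
    (M : R) :
  (forall i, `|f i| <= w i) -> (forall A, partial_sum w A <= M) ->
  cvg (partial_sum f @ totally).
Proof.
move=> fw wM.
have -> : partial_sum f = partial_sum (f \+ w) \- partial_sum w.
  by apply/funext => A; rewrite partial_sumD /= addrK.
apply: is_cvgB.
  apply: (@cvg_partial_sum_nneg _ _ _ (M + M)) => [i|A] /=.
    by have := fw i; rewrite ler_norml => /andP[]; lra.
  rewrite partial_sumD lerD ?wM //.
  apply: le_trans (wM A); apply: ler_sum => i _.
  exact: le_trans (ler_norm _) (fw _).
apply: (@cvg_partial_sum_nneg _ _ _ M) => // i.
exact: le_trans (fw i).
Qed.

(** * Double series along squares *)

Lemma fsubset_square (I : choiceType) (C : {fset I * I}) (A : {fset I}) :
  ([fset p.1 | p in C] `|` [fset p.2 | p in C] `<=` A)%fset ->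
  (C `<=` A `*` A)%fset.
Proof.
move=> CA; apply/fsubsetP => p pC; rewrite in_fsetM.
by rewrite !(fsubsetP CA) // in_fsetU ?[X in _ || X]in_imfset ?in_imfset ?orbT.
Qed.

(* Once the double series is known to converge, its sum can be computed along
   the squares A * A, which are cofinal among the finite sets of pairs. *)
Lemma cvg_partial_sum_prod (R : realType) (I : choiceType)
    (F : I * I -> R) (l : R) :
  cvg (partial_sum F @ totally) ->
  (fun A : {fset I} => partial_sum F (A `*` A)%fset) @ totally --> l ->
  partial_sum F @ totally --> l.
Proof.
move=> cF dl; suff -> : l = lim (partial_sum F @ totally) by [].
apply: (cvg_unique (@norm_hausdorff _ R) dl).
apply: (@cvg_comp _ _ _ (fun A : {fset I} => (A `*` A)%fset) _ _ (@totally _));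
  last exact: cF.
move=> S [C _ CS].
exists ([fset p.1 | p in C] `|` [fset p.2 | p in C])%fset => // A /= CA.
by apply: CS; exact: fsubset_square.
Qed.

(** * Gaussian sums over the integers *)

Lemma partial_sum_int_le (R : realType) (f : int -> R) (A : {fset int}) :
  (forall k, 0 <= f k) ->
  exists N, partial_sum f A <= \sum_(0 <= i < N) (f (Posz i) + f (Negz i)).
Proof.
(* A crude [N] that exceeds [|k|] for every [k] in [A]. *)
move=> f0; pose N := (\sum_(k <- A) `|k|.+1)%N; exists N.
pose s := map Posz (iota 0 N) ++ map Negz (iota 0 N).
have us : uniq s.
  rewrite cat_uniq !map_inj_uniq ?iota_uniq => [|i j []|i j []] //=.
  by rewrite andbT; apply/hasPn => _ /mapP[i _ ->]; apply/mapP => -[].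
have As k : k \in A -> k \in s.
  move=> kA; have kN : (`|k| < N)%N.
    by rewrite /N (big_rem k) //= leq_addr.
  rewrite mem_cat; case: k kN {kA} => i /= iN; apply/orP; [left|right].
    by apply/mapP; exists i; rewrite ?mem_iota.
  (* [Negz i] is [-(i + 1)], so its absolute value bound reads [i.+1 < N], one more than
     required. *)
  by apply/mapP; exists i; rewrite ?mem_iota //= add0n ltnW.
rewrite partial_sumE big_split /= /index_iota subn0.
rewrite -(big_map Posz xpredT f) -(big_map Negz xpredT f) -big_cat /= -/s.
rewrite (@perm_big _ _ _ _ _ (seq.filter (fun k => k \in A) s)) /=.
  by rewrite big_filter big_mkcond; apply: ler_sum => k _; case: ifP.
apply: uniq_perm; rewrite ?fset_uniq ?filter_uniq // => k.
by rewrite mem_filter; apply/idP/andP => [kA|[]//]; split => //; exact: As.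
Qed.

(** The indices i and -(i + 1) give the same odd square, and (2i + 1)^2 >= i, so the paired terms
    are at most twice those of the geometric series of ratio [expR (- c)]. *)
Lemma partial_sum_gaussian_le (R : realType) (c : R) (A : {fset int}) : 0 < c ->
  partial_sum (fun k : int => expR (- c * (2 * k%:~R + 1) ^+ 2)) A
  <= 2 / (1 - expR (- c)).
Proof.
move=> c0; have [|N] := @partial_sum_int_le _
  (fun k : int => expR (- c * (2 * k%:~R + 1) ^+ 2)) A.
  by move=> k; exact: expR_ge0.
move=> /le_trans; apply.
have r1 : expR (- c) < 1 by rewrite expR_lt1 oppr_lt0.
apply: (@le_trans _ _ (series (geometric 2 (expR (- c))) N)); last first.
  by apply: geometric_le_lim; rewrite ?expR_gt0 // ger0_norm ?expR_ge0.
apply: ler_sum => i _ /=; rewrite NegzE mulrNz.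
have -> : (2 * - i.+1%:~R + 1) ^+ 2 = (2 * i%:~R + 1) ^+ 2 :> R.
  by rewrite -!pmulrn -natr1; ring.
rewrite [leRHS]mulr_natl -expRM_natr -mulr2n ler_pMn2r // ler_expR -pmulrn.
rewrite !mulNr lerN2 ler_pM2l //.
have : 0 <= i%:R :> R by [].
by nra.
Qed.

(** * Real and imaginary parts of the theta series *)

Lemma cvg_partial_sum_complex (R : realType) (I : choiceType) (a b : I -> R)
    (x y : R) :
  partial_sum a @ totally --> x -> partial_sum b @ totally --> y ->
  partial_sum (fun i => (a i +i* b i)%C : R[i]^o) @ totally
  --> ((x +i* y)%C : R[i]^o).
Proof.
move=> ax by_; apply/cvgrPdist_le => -[e e'].
(* The radius is a complex number; its positivity forces a zero imaginary part. *)
rewrite ltcE /= => /andP[/eqP -> e0].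
have e20 : 0 < e / 2 by rewrite divr_gt0.
move/cvgrPdist_le : ax => /(_ _ e20) ax.
move/cvgrPdist_le : by_ => /(_ _ e20) by_.
near=> A.
have : `|x - partial_sum a A| <= e / 2 by near: A.
have : `|y - partial_sum b A| <= e / 2 by near: A.
have -> : partial_sum (fun i => (a i +i* b i)%C : R[i]^o) A
    = (partial_sum a A +i* partial_sum b A)%C.
  rewrite !partial_sumE; elim/big_rec3: _ => // i u v w _ ->.
  by [].
rewrite !ler_norml => /andP[y1 y2] /andP[x1 x2].
rewrite lecE /= eqxx /= -[leRHS](gtr0_norm e0) -sqrtr_sqr ler_sqrt ?sqr_ge0 //.
by nra.
Unshelve. all: by end_near. Qed.

(** The angle phi_k of the k-th term of theta_1 at real argument [x] and tau = -s + i beta; below,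
    [s] is t divided by the period. *)
Definition theta_phase (R : realType) (x s : R) (k : int) : R :=
  pi / 2 * (2 * x + 1) * (2 * k%:~R + 1) - pi * s / 4 * (2 * k%:~R + 1) ^+ 2.

Lemma theta1_termE (R : realType) (x s beta : R) (k : int) :
  cexp ('i%C * ((pi : R)%:C%C * (- s +i* beta)%C / 4) * (2 * k%:~R + 1) ^+ 2
        + 'i%C * ((pi : R)%:C%C / 2) * (2 * x%:C%C + 1) * (2 * k%:~R + 1))
  = (expR (- (pi * beta / 4) * (2 * k%:~R + 1) ^+ 2)
     * cos (theta_phase x s k)
   +i* (expR (- (pi * beta / 4) * (2 * k%:~R + 1) ^+ 2)
     * sin (theta_phase x s k)))%C.
Proof.
(* Every real constant is exhibited as an embedded real, so that [simpc] can separate the real and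
   imaginary parts. *)
have -> : 2 * k%:~R + 1 = (2 * k%:~R + 1 : R)%:C%C :> R[i].
  by rewrite rmorphD rmorphM rmorph1 rmorph_nat rmorph_int.
have -> : (4 : R[i])^-1 = (4^-1 : R)%:C%C by rewrite fmorphV rmorph_nat.
have -> : (2 : R[i])^-1 = (2^-1 : R)%:C%C by rewrite fmorphV rmorph_nat.
have -> : 2 * x%:C%C + 1 = (2 * x + 1)%:C%C :> R[i].
  by rewrite rmorphD rmorphM rmorph1 rmorph_nat.
rewrite /theta_phase; set q : R := 2 * k%:~R + 1.
rewrite /cexp expr2 /=; simpc.
by rewrite -expr2 ![- (pi * s / 4 * _) + _]addrC.
Qed.

(** * The terms of the double series and their period *)

Lemma periodE (R : realType) (m l hbar : R) (mu : nat) :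
    0 < m -> 0 < l -> 0 < hbar -> (1 <= mu)%N ->
  period m l hbar mu = m * l ^+ 2 / (2 * pi * hbar * mu%:R ^+ 2).
Proof.
move=> m0 l0 h0 mu0; rewrite /period /energy.
have mu_gt0 : 0 < mu%:R :> R by rewrite ltr0n.
move: (@pi R) (@pi_gt0 R) => p p0; field.
by rewrite !gt_eqF.
Qed.

(** Evenness of cosine: the Chebyshev index |k - n| may be replaced by the signed k - n. *)
Lemma cos_absz (R : realType) (k : int) (y : R) :
  cos (`|k|%N%:R * y) = cos (k%:~R * y).
Proof.
case: k => n; first by rewrite -pmulrn.
by rewrite NegzE abszN mulrNz mulNr cosN -pmulrn.
Qed.

(** The addition formula for cos (phi_k - phi_n) separates the variables n and k, so that each
    summand can be summed as a product of two single series. *)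
Lemma density_termE (R : realType) (m l hbar : R) (mu : nat) (beta x t : R)
    (p : int * int) :
  let w k := expR (- (pi * beta / 4) * (2 * k%:~R + 1) ^+ 2) in
  let ph := theta_phase (mu%:R * (x / l)) (t / period m l hbar mu) in
  density_term m l hbar mu beta x t p
  = w p.1 * cos (ph p.1) * (w p.2 * cos (ph p.2))
    + w p.1 * sin (ph p.1) * (w p.2 * sin (ph p.2)).
Proof.
case: p => n k w ph /=; rewrite chebyshevT_cos cos_absz mulrDr expRD.
rewrite -/(w k) -/(w n).
(* Uses (2k + 1)^2 - (2n + 1)^2 = 4 (k - n) (n + k + 1). *)
have -> : (k - n)%:~R * vartheta m l hbar mu n k x t = ph k - ph n.
  rewrite /vartheta /ph /theta_phase !intrD mulrNz.
  by move: (x / l) (period _ _ _ _)^-1 (@pi R) => y u v; field.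
by rewrite cosB; ring.
Qed.

Lemma cosB2pi_int (R : realType) (y : R) (j : int) :
  cos (y - pi * (j * 2)%:~R) = cos y.
Proof.
case: j => n.
  rewrite -[LHS](periodicn (@cosD2pi R) n); congr cos.
  by rewrite intrM -pmulrn -mulrnA -[_ *+ (2 * n)]mulr_natr natrM; ring.
rewrite -[RHS](periodicn (@cosD2pi R) n.+1); congr cos.
by rewrite NegzE intrM mulrNz -pmulrn -mulrnA -[_ *+ (2 * _)]mulr_natr natrM; ring.
Qed.

Lemma mul_succ_even (k : int) : exists j : int, k * (k + 1) = j * 2.
Proof.
elim/int_rect: k => [|n [j jE]|n [j jE]]; first by exists 0.
  (* Going from n to n + 1 adds 2 (n + 1) to the product; going from -n to -(n + 1) adds 2n. *)
  by exists (j + n.+1%:Z); rewrite mulrDl -jE intS; ring.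
by exists (j + n%:Z); rewrite mulrDl -jE intS; ring.
Qed.

Lemma density_termDperiod (R : realType) (m l hbar : R) (mu : nat)
    (beta x t : R) : period m l hbar mu != 0 ->
  density_term m l hbar mu beta x (t + period m l hbar mu)
  = density_term m l hbar mu beta x t.
Proof.
move=> T0; apply/funext => -[n k] /=; rewrite !chebyshevT_cos !cos_absz; congr *%R.
have [j jE] : exists j : int, (k - n) * (n + k + 1) = j * 2.
  have [a aE] := mul_succ_even k; have [b bE] := mul_succ_even n.
  exists (a - b); rewrite [RHS]mulrBl -aE -bE; ring.
have -> : (k - n)%:~R * vartheta m l hbar mu n k x (t + period m l hbar mu)
   = (k - n)%:~R * vartheta m l hbar mu n k x t - pi * ((k - n) * (n + k + 1))%:~R.
  rewrite /vartheta intrM.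
  by move: (x / l) (period _ _ _ _) T0 (@pi R) => y T T0 p; field.
by rewrite jE cosB2pi_int.
Qed.

(** * Summation of the double series *)

(** Domination by [w p.1 * w p.2] gives convergence; on squares the partial sums factor, which
    identifies the limit. *)
Lemma cvg_sumM (R : realType) (I : choiceType) (f g w : I -> R) (M : R) :
  (forall i, `|f i| <= w i) -> (forall i, `|g i| <= w i) ->
  (forall A, partial_sum w A <= M) ->
  partial_sum (fun p => f p.1 * g p.2) @ totally
  --> summability.sum f * summability.sum g.
Proof.
move=> fw gw wM; apply: cvg_partial_sum_prod.
  apply: (@cvg_partial_sum_dominated _ _ _ (fun p => w p.1 * w p.2) (M * M)).
    by move=> p; rewrite normrM ler_pM.
  have w0 i : 0 <= w i by exact: le_trans (fw i).
  (* An arbitrary finite set of pairs is enlarged to a square, where the bound is [M * M]. *)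
  move=> C; pose A := ([fset p.1 | p in C] `|` [fset p.2 | p in C])%fset.
  apply: (@le_trans _ _ (partial_sum (fun p => w p.1 * w p.2) (A `*` A)%fset)).
    apply: partial_sum_subset => [p|]; first by rewrite mulr_ge0.
    exact: fsubset_square.
  by rewrite partial_sumM ler_pM ?partial_sum_ge0.
under eq_fun do rewrite partial_sumM.
by apply: cvgM; apply: (cvg_partial_sum_dominated _ wM).
Qed.

Lemma cvg_density_term (R : realType) (m l hbar beta : R) (mu : nat) (x t : R) :
    0 < beta ->
  partial_sum (density_term m l hbar mu beta x t) @ totally -->
  Normc.normc (theta1 (mu%:R * (x / l))%:C%C
     (- (t / period m l hbar mu) +i* beta)%C) ^+ 2.
Proof.
move=> beta0; set ph := theta_phase (mu%:R * (x / l)) (t / period m l hbar mu).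
pose w (k : int) : R := expR (- (pi * beta / 4) * (2 * k%:~R + 1) ^+ 2).
have [M wM] : exists M, forall A, partial_sum w A <= M.
  exists (2 / (1 - expR (- (pi * beta / 4)))) => A.
  by apply: partial_sum_gaussian_le; rewrite divr_gt0 ?mulr_gt0 ?pi_gt0.
(* Real and imaginary parts of the theta_1 terms; the squared modulus of the sum is (sum a)^2 + (sum
   b)^2. *)
pose a k := w k * cos (ph k); pose b k := w k * sin (ph k).
have aw k : `|a k| <= w k.
  by rewrite normrM ger0_norm ?expR_ge0 // ler_piMr ?expR_ge0 ?cos_max.
have bw k : `|b k| <= w k.
  by rewrite normrM ger0_norm ?expR_ge0 // ler_piMr ?expR_ge0 ?sin_max.
have ca := cvg_partial_sum_dominated aw wM.
have cb := cvg_partial_sum_dominated bw wM.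
have -> : theta1 (mu%:R * (x / l))%:C%C (- (t / period m l hbar mu) +i* beta)%C
    = (summability.sum a +i* summability.sum b)%C.
  rewrite /theta1; under eq_fun do rewrite theta1_termE.
  apply: (@norm_cvg_lim _ (R[i]^o)).
  exact: cvg_partial_sum_complex.
rewrite /Normc.normc sqr_sqrtr ?addr_ge0 ?sqr_ge0 // !expr2.
have -> : density_term m l hbar mu beta x t
    = (fun p => a p.1 * a p.2) \+ (fun p => b p.1 * b p.2).
  by apply/funext => p; rewrite density_termE.
by rewrite partial_sumD; apply: cvgD; apply: cvg_sumM wM.
Qed.

(** * Normalisation, and the density as a periodic function of time *)

(** Serves to undo the square root in [Psi], since [Num.sqrt] is 0 on negative numbers. The sign
    passes to the limit because the Gaussian bound makes the series converge. *)
Lemma normN_ge0 (R : realType) (l beta : R) : 0 < l -> 0 < beta ->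
  0 <= normN l beta.
Proof.
move=> l0 beta0; apply: mulr_ge0; first exact: ltW.
apply: limr_ge; last first.
  by near=> A; apply: partial_sum_ge0 => k; exact: expR_ge0.
apply: (@cvg_partial_sum_nneg _ _ _ (2 / (1 - expR (- (pi * beta / 2))))).
  by move=> k; exact: expR_ge0.
move=> A; apply: partial_sum_gaussian_le.
by rewrite divr_gt0 ?mulr_gt0 ?pi_gt0.
Unshelve. all: by end_near. Qed.

Unset Implicit Arguments.
Set Strict Implicit.

Theorem theorem2 (R : realType) (m l hbar beta : R) (mu : nat)
    (m_gt0 : 0 < m) (l_gt0 : 0 < l) (hbar_gt0 : 0 < hbar) (beta_gt0 : 0 < beta)
    (mu_gt0 : (1 <= mu)%N) :
  [/\ period m l hbar mu = m * l ^+ 2 / (2 * pi * hbar * mu%:R ^+ 2),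
      forall x t : R, 0 <= x <= l ->
        cvg (partial_sum (density_term m l hbar mu beta x t) @ totally) /\
        density m l hbar mu beta x t
        = 1 / normN l beta
          * summability.sum (density_term m l hbar mu beta x t),
      forall x : R, 0 <= x <= l ->
        periodic (density m l hbar mu beta x) (period m l hbar mu) &
      forall x : R, 0 <= x <= l ->
        density m l hbar mu beta x 0
        = density m l hbar mu beta x (period m l hbar mu)].
Proof.
have TE := periodE m_gt0 l_gt0 hbar_gt0 mu_gt0.
have T0 : period m l hbar mu != 0.
  rewrite TE gt_eqF // divr_gt0 ?mulr_gt0 ?exprn_gt0 ?pi_gt0 ?ltr0n //.
have sE x t := @cvg_density_term R m l hbar beta mu x t beta_gt0.
have densityE x t : density m l hbar mu beta x t
    = 1 / normN l beta * summability.sum (density_term m l hbar mu beta x t).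
  rewrite /summability.sum (norm_cvg_lim (sE x t)) /density /Psi.
  rewrite Normc.normcM exprMn; congr (_ * _ ^+ 2).
    rewrite /Normc.normc /= expr0n addr0 sqrtr_sqr real_normK ?num_real //.
    by rewrite !div1r exprVn sqr_sqrtr // normN_ge0.
  (* The real part of tau in [Psi] is minus t divided by the period. *)
  suff -> : mu%:R ^+ 2 * (2 * pi * hbar / (m * l ^+ 2)) * t
      = t / period m l hbar mu by [].
  by rewrite TE invf_div; ring.
have periodicE x : periodic (density m l hbar mu beta x) (period m l hbar mu).
  (* Each term of the double series is already periodic, hence so is the sum. *)
  by move=> t; rewrite !densityE density_termDperiod.
split=> // [x t _|x _].
  by split=> //; apply/cvg_ex; eexists; exact: sE.
by rewrite -[in RHS](add0r (period _ _ _ _)) periodicE.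
Qed.
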